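(* (1) For $i\in\{1,2\}$ and every $i$-MDP, $[\preceq_i]=[\preceq_{12}]$. (2) There exist a deterministic 2-MDP $G$ and states $s,t$ of $G$ with $[s\preceq_1 t]<[s\preceq_{12} t]$. (3) There exist a deterministic 2-MDP $G$ and states $s,t$ of $G$ with $[s\preceq_1 t]>[s\preceq_{12} t]$.
   Context: A game structure $G=(S,[\cdot],\mathit{Moves},\Gamma_1,\Gamma_2,\delta)$: finite state set $S$; finite set $V$ of observation variables, each $v$ interpreted as $[v]:S\to[0,1]$; finite move set; $\Gamma_1,\Gamma_2:S\to2^{\mathit{Moves}}\setminus\{\emptyset\}$; $\delta:S\times\mathit{Moves}\times\mathit{Moves}\to\mathrm{Distr}(S)$. $G$ is an $i$-MDP if $|\Gamma_{3-i}(s)|=1$ for all $s$; it is deterministic if every $\delta(s,a_1,a_2)$ is a point mass. $\bar i=3-i$. Mixed moves $\mathcal{D}_i(s)=\mathrm{Distr}(\Gamma_i(s))$; $\delta(s,x_1,x_2)(u)=\sum_{a_1,a_2}\delta(s,a_1,a_2)(u)x_1(a_1)x_2(a_2)$. Valuations $k:S\to[0,1]$; $\mathrm{E}^{x_1,x_2}_s(k)=\sum_u\delta(s,x_1,x_2)(u)k(u)$; $\mathrm{Pre}_i(k)(s)=\sup_{x_i\in\mathcal{D}_i(s)}\inf_{x_{\bar i}\in\mathcal{D}_{\bar i}(s)}\mathrm{E}^{x_1,x_2}_s(k)$. Directed metrics $d:S\times S\to\mathbb{R}_{\ge0}$ ($d(s,s)=0$, triangle inequality), ordered pointwise; $\sqcup=\max$;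 $C(d)=\{k:k(s)-k(t)\le d(s,t)\ \forall s,t\}$; $[s\equiv t]=\max_v|[v](s)-[v](t)|$. $H_{\preceq_i}(d)(s,t)=[s\equiv t]\sqcup\sup_{k\in C(d)}(\mathrm{Pre}_i(k)(s)-\mathrm{Pre}_i(k)(t))$ and $[\preceq_i]$ is its least fixpoint. $H_{\preceq_{12}}(d)(s,t)=[s\equiv t]\sqcup\sup_{k\in C(d)}\sup_{x_1\in\mathcal{D}_1(s)}\sup_{x_2\in\mathcal{D}_2(s)}\inf_{y_2\in\mathcal{D}_2(t)}\inf_{y_1\in\mathcal{D}_1(t)}(\mathrm{E}^{x_1,x_2}_s(k)-\mathrm{E}^{y_1,y_2}_t(k))$ and $[\preceq_{12}]$ is its least fixpoint. $[s\preceq t]$ denotes $[\preceq](s,t)$. *)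

(* Defs.v *)
From mathcomp Require Export all_boot all_order all_algebra.
From mathcomp Require Export all_classical all_reals.

Set Implicit Arguments.
Unset Strict Implicit.
Unset Printing Implicit Defensive.

Import Order.TTheory GRing.Theory Num.Theory.

Local Open Scope classical_set_scope.
Local Open Scope ring_scope.

(* Distr(A) for a subset A of a finite type T: an element of Distr(A) is
   represented by its extension by 0 to the whole of T. *)
Definition distr (R : realType) (T : finType) (A : {set T}) : set (T -> R) :=
  [set p | [/\ forall a, 0 <= p a <= 1,
               forall a, a \notin A -> p a = 0 &
               \sum_(a in A) p a = 1]].

Inductive player := P1 | P2.

Definition opponent (i : player) : player :=
  match i with P1 => P2 | P2 => P1 end.

Record game_structure (R : realType) := GameStructure {
  state : finType;
  obsvar : finType;
  obs : obsvar -> state -> R;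
  obs_01 : forall v s, 0 <= obs v s <= 1;
  move : finType;
  avail : player -> state -> {set move};
  avail_neq0 : forall i s, avail i s != finset.set0;
  trans : state -> move -> move -> state -> R;
  trans_distr : forall s a1 a2, distr [set: state]%SET (trans s a1 a2)
}.

Arguments obs {R} g v s.
Arguments avail {R} g i s.
Arguments trans {R} g s a1 a2 u.

Definition is_MDP (R : realType) (i : player) (G : game_structure R) : Prop :=
  forall s : state G, #|avail G (opponent i) s| = 1%N.

Definition deterministic (R : realType) (G : game_structure R) : Prop :=
  forall (s : state G) (a1 a2 : move G),
    exists u : state G, forall w, trans G s a1 a2 w = (w == u)%:R.

Section Games.
Variables (R : realType) (G : game_structure R).

Local Notation S := (state G).

Definition mixed (i : player) (s : S) : set (move G -> R) :=
  distr (avail G i s).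

Definition mixed_trans (s : S) (x1 x2 : move G -> R) (u : S) : R :=
  \sum_(a1 in avail G P1 s) \sum_(a2 in avail G P2 s)
    trans G s a1 a2 u * x1 a1 * x2 a2.

Definition valuation : set (S -> R) := [set k | forall s, 0 <= k s <= 1].

Definition expect (s : S) (x1 x2 : move G -> R) (k : S -> R) : R :=
  \sum_(u : S) mixed_trans s x1 x2 u * k u.

Definition Pre (i : player) (k : S -> R) (s : S) : R :=
  match i with
  | P1 => sup [set inf [set expect s x1 x2 k | x2 in mixed P2 s]
              | x1 in mixed P1 s]
  | P2 => sup [set inf [set expect s x1 x2 k | x1 in mixed P1 s]
              | x2 in mixed P2 s]
  end.

Definition directed_metric (d : S -> S -> R) : Prop :=
  [/\ forall s t, 0 <= d s t,
      forall s, d s s = 0 &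
      forall s t u, d s u <= d s t + d t u].

Definition nonexpansive (d : S -> S -> R) : set (S -> R) :=
  [set k | valuation k /\ forall s t, k s - k t <= d s t].

(* The default value 0 of the big maximum is only relevant without
   observation variables. *)
Definition obs_dist (s t : S) : R :=
  \big[Num.max/0]_(v : obsvar G) `|obs G v s - obs G v t|.

Definition H_sim (i : player) (d : S -> S -> R) (s t : S) : R :=
  Num.max (obs_dist s t)
    (sup [set Pre i k s - Pre i k t | k in nonexpansive d]).

Definition H_sim12 (d : S -> S -> R) (s t : S) : R :=
  Num.max (obs_dist s t)
    (sup [set
       sup [set
         sup [set
           inf [set
             inf [set expect s x1 x2 k - expect t y1 y2 k
                 | y1 in mixed P1 t]
             | y2 in mixed P2 t]
           | x2 in mixed P2 s]
         | x1 in mixed P1 s]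
       | k in nonexpansive d]).

Definition is_least_fixpoint (F : (S -> S -> R) -> (S -> S -> R))
    (d : S -> S -> R) : Prop :=
  [/\ directed_metric d,
      F d = d &
      forall d', directed_metric d' -> F d' = d' -> forall s t, d s t <= d' s t].

(* The default value of xget is irrelevant for H_sim and H_sim12: see
   sim_distP and sim12_distP below. *)
Definition lfp (F : (S -> S -> R) -> (S -> S -> R)) : S -> S -> R :=
  xget (fun _ _ => 0) [set d | is_least_fixpoint F d].

Definition sim_dist (i : player) : S -> S -> R := lfp (H_sim i).

Definition sim12_dist : S -> S -> R := lfp H_sim12.

End Games.

Arguments sim_dist {R} G i s t.
Arguments sim12_dist {R} G s t.

Section SupImage.
Variables (R : realType) (T : Type).
Implicit Types (A : set T) (f g : T -> R) (c : R).

Lemma le_sup_image A f c a :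
  (forall x, A x -> f x <= c) -> A a -> f a <= sup [set f x | x in A].
Proof.
move=> fc Aa; apply: ub_le_sup; last by exists a.
by exists c => _ [x Ax <-]; exact: fc.
Qed.

Lemma sup_image_le A f c :
  A !=set0 -> (forall x, A x -> f x <= c) -> sup [set f x | x in A] <= c.
Proof.
move=> [a Aa] fc; apply: ge_sup; first by exists (f a), a.
by move=> _ [x Ax <-]; exact: fc.
Qed.

Lemma inf_image_le A f c a :
  (forall x, A x -> c <= f x) -> A a -> inf [set f x | x in A] <= f a.
Proof.
move=> fc Aa; apply: ge_inf; last by exists a.
by exists c => _ [x Ax <-]; exact: fc.
Qed.

Lemma le_inf_image A f c :
  A !=set0 -> (forall x, A x -> c <= f x) -> c <= inf [set f x | x in A].
Proof.
move=> [a Aa] fc; apply: lb_le_inf; first by exists (f a), a.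
by move=> _ [x Ax <-]; exact: fc.
Qed.

Lemma sup_image01 A f : A !=set0 -> (forall x, A x -> 0 <= f x <= 1) ->
  0 <= sup [set f x | x in A] <= 1.
Proof.
move=> A0 f01; have f1 x : A x -> f x <= 1 by move=> /f01 /andP[].
apply/andP; split; last exact: sup_image_le.
have [a Aa] := A0; have /andP[fa0 _] := f01 _ Aa.
by apply: (le_trans fa0); exact: (le_sup_image f1).
Qed.

Lemma inf_image01 A f : A !=set0 -> (forall x, A x -> 0 <= f x <= 1) ->
  0 <= inf [set f x | x in A] <= 1.
Proof.
move=> A0 f01; have f0 x : A x -> 0 <= f x by move=> /f01 /andP[].
apply/andP; split; first exact: le_inf_image.
have [a Aa] := A0; have /andP[_ fa1] := f01 _ Aa.
by apply: le_trans fa1; exact: (inf_image_le f0).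
Qed.

Lemma sup_imageB A f b c : A !=set0 -> (forall x, A x -> f x <= b) ->
  sup [set f x - c | x in A] = sup [set f x | x in A] - c.
Proof.
move=> A0 fb; apply/eqP; rewrite eq_le; apply/andP; split.
  by apply: sup_image_le => // x Ax; rewrite lerB// (le_sup_image fb).
rewrite lerBlDr; apply: sup_image_le => // x Ax; rewrite -lerBlDr.
by apply: (@le_sup_image _ (fun x => f x - c) (b - c)) => // y Ay; rewrite lerB// fb.
Qed.

Lemma inf_imageB A f b c : A !=set0 -> (forall x, A x -> f x <= b) ->
  inf [set c - f x | x in A] = c - sup [set f x | x in A].
Proof.
move=> A0 fb; apply/eqP; rewrite eq_le; apply/andP; split; last first.
  by apply: le_inf_image => // x Ax; rewrite lerB// (le_sup_image fb).
rewrite lerBrDl -lerBrDr; apply: sup_image_le => // x Ax.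
rewrite lerBrDr -lerBrDl.
by apply: (@inf_image_le _ (fun x => c - f x) (c - b)) => // y Ay; rewrite lerB// fb.
Qed.

End SupImage.

Section Existence.
Variables (R : realType) (G : game_structure R).

Local Notation S := (state G).
Implicit Types (d : S -> S -> R) (k : S -> R).

Lemma mixed_neq0 i (s : S) : mixed i s !=set0.
Proof.
have /set0Pn[a ain] := avail_neq0 i s.
exists (fun b => (b == a)%:R); split.
- by move=> b; case: (b == a); rewrite ?lexx ler01.
- by move=> b bn; case: eqP => // ba; rewrite ba ain in bn.
- rewrite (bigD1 a)//= eqxx big1 ?addr0// => b /andP[_ /negbTE ->].
  by [].
Qed.

Lemma expect_01 (s : S) x1 x2 k :
  mixed P1 s x1 -> mixed P2 s x2 -> valuation k -> 0 <= expect s x1 x2 k <= 1.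
Proof.
move=> [x1_01 _ x1_1] [x2_01 _ x2_1] k01.
have m0 u : 0 <= mixed_trans s x1 x2 u.
  apply: sumr_ge0 => a1 _; apply: sumr_ge0 => a2 _.
  have [/(_ u)/andP[t0 _] _ _] := trans_distr s a1 a2.
  have /andP[y1 _] := x1_01 a1; have /andP[y2 _] := x2_01 a2.
  by rewrite !mulr_ge0.
apply/andP; split.
  by apply: sumr_ge0 => u _; rewrite mulr_ge0//; have /andP[] := k01 u.
apply: (@le_trans _ _ (\sum_(u : S) mixed_trans s x1 x2 u)).
  by apply: ler_sum => u _; rewrite ler_piMr//; have /andP[] := k01 u.
rewrite /mixed_trans exchange_big/= -x1_1; apply: ler_sum => a1 _.
rewrite exchange_big/= -[leRHS]mulr1 -x2_1 mulr_sumr; apply: ler_sum => a2 _.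
have [_ _] := trans_distr s a1 a2; rewrite big_mkcond/= => t1.
rewrite -!mulr_suml.
suff -> : \sum_u trans G s a1 a2 u = 1 by rewrite mul1r.
by rewrite -t1; apply: eq_bigr => u _; rewrite finset.in_setT.
Qed.

Lemma Pre_01 i k (s : S) : valuation k -> 0 <= Pre i k s <= 1.
Proof.
move=> k01; case: i => /=; apply: sup_image01 (mixed_neq0 _ _) _ => x xm;
  apply: inf_image01 (mixed_neq0 _ _) _ => y ym; exact: expect_01.
Qed.

Definition max_expect k (s : S) : R :=
  sup [set sup [set expect s x1 x2 k | x2 in mixed P2 s] | x1 in mixed P1 s].

Lemma max_expect_01 k s : valuation k -> 0 <= max_expect k s <= 1.
Proof.
move=> k01; apply: sup_image01 (mixed_neq0 _ _) _ => x xm.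
by apply: sup_image01 (mixed_neq0 _ _) _ => y ym; exact: expect_01.
Qed.

Lemma expect_le1 k (s : S) x1 x2 : valuation k ->
  mixed P1 s x1 -> mixed P2 s x2 -> expect s x1 x2 k <= 1.
Proof. by move=> k01 m1 m2; have /andP[] := expect_01 m1 m2 k01. Qed.

Lemma sup12E k (s t : S) : valuation k ->
  sup [set
    sup [set
      inf [set
        inf [set expect s x1 x2 k - expect t y1 y2 k | y1 in mixed P1 t]
        | y2 in mixed P2 t]
      | x2 in mixed P2 s]
    | x1 in mixed P1 s] = max_expect k s - max_expect k t.
Proof.
move=> k01.
pose N := sup [set sup [set expect t y1 y2 k | y1 in mixed P1 t]
                | y2 in mixed P2 t].
have le1 y2 : mixed P2 t y2 ->
    sup [set expect t y1 y2 k | y1 in mixed P1 t] <= 1.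
  by move=> m2; apply: sup_image_le (mixed_neq0 _ _) _ => y1 m1; exact: expect_le1.
have le1' y1 : mixed P1 t y1 ->
    sup [set expect t y1 y2 k | y2 in mixed P2 t] <= 1.
  by move=> m1; apply: sup_image_le (mixed_neq0 _ _) _ => y2 m2; exact: expect_le1.
have NE : N = max_expect k t.
  apply/eqP; rewrite eq_le; apply/andP; split.
    apply: sup_image_le (mixed_neq0 _ _) _ => y2 m2.
    apply: sup_image_le (mixed_neq0 _ _) _ => y1 m1.
    apply: le_trans (le_sup_image le1' m1).
    by apply: (@le_sup_image _ _ _ (expect t y1 ^~ k) 1) => // z mz; exact: expect_le1.
  apply: sup_image_le (mixed_neq0 _ _) _ => y1 m1.
  apply: sup_image_le (mixed_neq0 _ _) _ => y2 m2.
  apply: le_trans (le_sup_image le1 m2).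
  by apply: (@le_sup_image _ _ _ (fun z => expect t z y2 k) 1) => // z mz; exact: expect_le1.
rewrite -NE.
have inner x1 x2 : 
    inf [set inf [set expect s x1 x2 k - expect t y1 y2 k | y1 in mixed P1 t]
        | y2 in mixed P2 t] = expect s x1 x2 k - N.
  rewrite -(inf_imageB _ (mixed_neq0 _ _) le1); congr inf.
  apply: eq_imagel => y2 m2.
  by rewrite (@inf_imageB _ _ _ _ 1)//; [exact: mixed_neq0|move=> y1 m1; exact: expect_le1].
rewrite -(@sup_imageB _ _ _ _ 1); [|exact: mixed_neq0|]; last first.
  by move=> x1 m1; apply: sup_image_le (mixed_neq0 _ _) _ => x2 m2; exact: expect_le1.
congr sup; apply: eq_imagel => x1 m1.
rewrite -(@sup_imageB _ _ _ _ 1); [|exact: mixed_neq0|]; last first.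
  by move=> x2 m2; exact: expect_le1.
by congr sup; apply: eq_imagel => x2 m2; exact: inner.
Qed.

Lemma obs_dist_ge0 (s t : S) : 0 <= obs_dist s t.
Proof. by apply: (big_ind (fun x => 0 <= x)) => // x y; rewrite le_max => ->. Qed.

Lemma obs_dist_xx (s : S) : obs_dist s s = 0.
Proof.
apply: (big_ind (fun x => x = 0)) => // [x y -> ->|v _].
  exact: maxxx.
by rewrite subrr normr0.
Qed.

Lemma obs_dist_sup (s t : S) c :
  0 <= c -> (forall v, `|obs G v s - obs G v t| <= c) -> obs_dist s t <= c.
Proof.
move=> c0 cv; apply: (big_ind (fun x => x <= c)) => // x y.
by rewrite ge_max => -> ->.
Qed.

Lemma obs_le_dist (s t : S) v : `|obs G v s - obs G v t| <= obs_dist s t.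
Proof. by rewrite /obs_dist (bigD1 v)//= le_max lexx. Qed.

Lemma obs_dist_le1 (s t : S) : obs_dist s t <= 1.
Proof.
apply: obs_dist_sup => // v.
have /andP[a0 a1] := obs_01 v s; have /andP[b0 b1] := obs_01 v t.
rewrite ler_norml; apply/andP; split.
  by rewrite -[leLHS]add0r lerB.
by rewrite -[leRHS]subr0 lerB.
Qed.

Lemma obs_dist_triangle (s t u : S) : obs_dist s u <= obs_dist s t + obs_dist t u.
Proof.
apply: obs_dist_sup => [|v]; first by rewrite addr_ge0// obs_dist_ge0.
by apply: le_trans (ler_distD (obs G v t) _ _) _; rewrite lerD// obs_le_dist.
Qed.

Lemma nonexpansive_neq0 d : directed_metric d -> nonexpansive d !=set0.
Proof.
move=> [d0 _ _]; exists (fun _ => 0); split => [s|s t].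
  by rewrite lexx ler01.
by rewrite subrr.
Qed.

(* H_sim i is gen_H (Pre i) by definition, H_sim12 is gen_H max_expect by
   H_sim12E below. *)
Definition gen_H (f : (S -> R) -> S -> R) d (s t : S) : R :=
  Num.max (obs_dist s t) (sup [set f k s - f k t | k in nonexpansive d]).

Section LeastFixpoint.
Variables (f : (S -> R) -> S -> R)
  (f01 : forall k s, valuation k -> 0 <= f k s <= 1).

Lemma gen_sub_le1 d k s t : nonexpansive d k -> f k s - f k t <= 1.
Proof.
move=> [k01 _]; have /andP[_ a1] := f01 s k01; have /andP[b0 _] := f01 t k01.
by rewrite -[leRHS]subr0 lerB.
Qed.

Lemma gen_sub_le d k s t : nonexpansive d k -> f k s - f k t <= gen_H f d s t.
Proof.
move=> dk; rewrite le_max; apply/orP; right.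
by apply: (@le_sup_image _ _ _ (fun k => f k s - f k t) 1) => // k' /gen_sub_le1.
Qed.

Lemma gen_H_le d s t c : directed_metric d -> obs_dist s t <= c ->
  (forall k, nonexpansive d k -> f k s - f k t <= c) -> gen_H f d s t <= c.
Proof.
move=> dm oc kc; rewrite ge_max oc/=.
by apply: sup_image_le => //; exact: nonexpansive_neq0.
Qed.

Lemma gen_H_le1 d s t : directed_metric d -> gen_H f d s t <= 1.
Proof.
move=> dm; apply: gen_H_le => //; first exact: obs_dist_le1.
by move=> k /gen_sub_le1.
Qed.

Lemma gen_H_metric d : directed_metric d -> directed_metric (gen_H f d).
Proof.
move=> dm; split => [s t|s|s t u].
- by rewrite le_max obs_dist_ge0.
- apply/eqP; rewrite eq_le {2}/gen_H le_max obs_dist_ge0 andbT.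
  by apply: gen_H_le => // [|k _]; rewrite ?obs_dist_xx ?subrr.
- apply: gen_H_le => // [|k dk].
    apply: le_trans (obs_dist_triangle s t u) _.
    by rewrite lerD// le_max lexx.
  by rewrite -(subrKA (f k t)) lerD// gen_sub_le.
Qed.

Lemma gen_H_homo d d' : directed_metric d -> (forall s t, d s t <= d' s t) ->
  forall s t, gen_H f d s t <= gen_H f d' s t.
Proof.
move=> dm dd' s t; apply: gen_H_le => // [|k [k01 kd]].
  by rewrite le_max lexx.
by apply: gen_sub_le; split => // x y; apply: le_trans (dd' x y).
Qed.

(* Tarski's argument, as a supremum of post-fixpoints: pointwise suprema of
   directed metrics are directed metrics, unlike pointwise infima. *)
Lemma gen_lfp_exists : exists d, is_least_fixpoint (gen_H f) d.
Proof.
pose pre d := directed_metric d /\ forall s t, gen_H f d s t <= d s t.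
pose P := [set d | [/\ directed_metric d,
  forall s t, d s t <= gen_H f d s t &
  forall d', pre d' -> forall s t, d s t <= d' s t]].
have P0 : P (fun _ _ => 0).
  split; first by split=> // *; rewrite addr0.
    by move=> s t; rewrite le_max obs_dist_ge0.
  by move=> d' [[d'0 _ _] _].
have Pn : P !=set0 by exists (fun _ _ => 0).
have P1 s t d : P d -> d s t <= 1.
  by move=> [dm dH _]; apply: le_trans (dH s t) _; exact: gen_H_le1.
pose L (s t : S) : R := sup [set d s t | d in P].
have leL s t d : P d -> d s t <= L s t.
  by move=> Pd; apply: (@le_sup_image _ _ P (fun d => d s t) 1) => // d' /P1.
have Lle s t c : (forall d, P d -> d s t <= c) -> L s t <= c.
  by move=> Pc; apply: sup_image_le.
have Lm : directed_metric L.
  split=> [s t|s|s t u].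
  - exact: (leL s t _ P0).
  - apply/eqP; rewrite eq_le (leL s s _ P0) andbT; apply: Lle => d [[_ d0 _] _ _].
    by rewrite d0.
  - apply: Lle => d Pd; have [[_ _ dt] _ _] := Pd.
    by apply: le_trans (dt s t u) _; rewrite lerD// leL.
have LH s t : L s t <= gen_H f L s t.
  apply: Lle => d Pd; have [dm dH _] := Pd.
  by apply: le_trans (dH s t) _; apply: gen_H_homo => // x y; exact: leL.
have Lpre d' : pre d' -> forall s t, L s t <= d' s t.
  by move=> pd' s t; apply: Lle => d [_ _]; exact.
have PHL : P (gen_H f L).
  split; first exact: gen_H_metric.
    by apply: gen_H_homo.
  move=> d' pd' s t; have [_ Hd'] := pd'.
  by apply: le_trans (Hd' s t); apply: gen_H_homo => //; exact: Lpre.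
exists L; split => //.
  apply/funext => s; apply/funext => t; apply/eqP; rewrite eq_le LH andbT.
  exact: leL.
by move=> d' dm' Hd'; apply: Lpre; split => // s t; rewrite Hd'.
Qed.

End LeastFixpoint.

Lemma H_sim12E : @H_sim12 R G = gen_H max_expect.
Proof.
apply/funext => d; apply/funext => s; apply/funext => t; congr Num.max.
by congr sup; apply: eq_imagel => k [k01 _]; exact: sup12E.
Qed.

Lemma lfpP (F : (S -> S -> R) -> (S -> S -> R)) :
  (exists d, is_least_fixpoint F d) -> is_least_fixpoint F (lfp F).
Proof. exact: xgetPex. Qed.

Lemma sim_distP i : is_least_fixpoint (@H_sim R G i) (sim_dist G i).
Proof.
by apply: lfpP; apply: (@gen_lfp_exists (Pre i)) => k s; exact: Pre_01.
Qed.

Lemma sim12_distP : is_least_fixpoint (@H_sim12 R G) (sim12_dist G).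
Proof.
apply: lfpP; rewrite H_sim12E; apply: gen_lfp_exists => k s.
exact: max_expect_01.
Qed.

End Existence.

(* Main.v *)
Require Import Defs.

Set Implicit Arguments.
Unset Strict Implicit.
Unset Printing Implicit Defensive.

Import Order.TTheory GRing.Theory Num.Theory.

Local Open Scope classical_set_scope.
Local Open Scope ring_scope.

(** In an [i]-MDP the opponent has a single mixed move, so the inner infimum of
    [Pre i] and the corresponding supremum of [max_expect] range over the same
    one-point set, and the two functionals whose least fixpoints are compared
    coincide.

    For the strict inequalities one game serves both directions. Player 1 is
    trivial, [Some true] and [Some false] are absorbing, and from [None] player 2
    moves to either of them; only [Some true] has observation 1. Player 1 values
    [None] at the minimum of the two successors, whereas [max_expect] takes their
    maximum. Hence [None] is 1-simulated by [Some false] at distance 0 and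
    [Some false] is 12-simulated by [None] at distance 0, while the valuations
    [obs] and [1 - obs] witness distance 1 for the other relation. *)

(** * Distributions on finite sets: singletons and point masses *)

Section Distributions.
Variables (R : realType) (T : finType) (A : {set T}).

(** Normalisation forces the value 1 at the only point of [A], and values off [A] are 0. Passing a
    member [p] avoids naming that point. *)
Lemma distr_card1 (p : T -> R) :
  #|A| = 1%N -> distr A p -> distr A = [set p].
Proof.
move=> /eqP/finset.cards1P[a ->] pA.
apply/seteqP; split => [q qA|_ -> //]; apply/funext => b.
have [_ p0] := pA; have [_ q0] := qA; rewrite !big_set1 => qa pa.
have [->|ba] := eqVneq b a; first by rewrite pa qa.
by rewrite p0 ?q0// finset.in_set1.
Qed.

Lemma dirac_distr (a : T) :
  a \in A -> distr A (fun b => (b == a)%:R : R).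
Proof.
move=> aA; split => [b|b bA|].
- by case: eqP; rewrite ?lexx ?ler01.
- by case: eqP => // ba; rewrite ba aA in bA.
- by rewrite (bigD1 a)//= eqxx big1 ?addr0// => b /andP[_ /negbTE ->].
Qed.

End Distributions.

(** * Collapse of the two distances on MDPs; bounds on expectations and fixpoints *)

Section Distances.
Variables (R : realType) (G : game_structure R).
Local Notation S := (state G).
Implicit Types (k : S -> R) (d : S -> S -> R).

Lemma MDP_Pre_max_expect i k s : is_MDP i G -> Pre i k s = max_expect k s.
Proof.
move=> /(_ s); rewrite /max_expect; case: i => /= /distr_card1 one.
- have [x xm] := mixed_neq0 P2 s.
  rewrite [mixed P2 s](one _ _ xm); congr sup; apply: eq_imagel => y _.
  by rewrite image_set1 inf1 sup1.
(* Now the one-point set indexes the outer supremum of [max_expect] but the inner infimum of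
   [Pre P2], so the two sides collapse at different levels. *)
- have [x xm] := mixed_neq0 P1 s.
  rewrite [mixed P1 s](one _ _ xm) image_set1 sup1; congr sup.
  by apply: eq_imagel => y _; rewrite image_set1 inf1.
Qed.

Lemma MDP_sim_dist i : is_MDP i G -> sim_dist G i = sim12_dist G.
Proof.
move=> GP; rewrite /sim_dist /sim12_dist H_sim12E; congr lfp.
apply/funext => d; apply/funext => s; apply/funext => t; congr Num.max.
by congr sup; apply: eq_imagel => k _; rewrite !MDP_Pre_max_expect.
Qed.

Lemma sim_dist_fix i : gen_H (Pre i) (sim_dist G i) = sim_dist G i.
Proof. by have [] := sim_distP G i. Qed.

Lemma sim12_dist_fix : gen_H (@max_expect R G) (sim12_dist G) = sim12_dist G.
Proof. by rewrite -H_sim12E; have [] := sim12_distP G. Qed.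

(** An expectation is a weighted average over pure move pairs. Restricting to the support of [x2]
    covers both absorbing states and pure moves of player 2. *)
Lemma expect_const (s : S) x1 x2 k c : mixed P1 s x1 -> mixed P2 s x2 ->
  (forall a1 a2, x2 a2 != 0 -> \sum_u trans G s a1 a2 u * k u = c) ->
  expect s x1 x2 k = c.
Proof.
move=> [_ _ x1s] [_ _ x2s] kc; rewrite /expect /mixed_trans.
under eq_bigr do rewrite mulr_suml.
rewrite exchange_big/= -[RHS]mul1r -x1s mulr_suml; apply: eq_bigr => a1 _.
under eq_bigr do rewrite mulr_suml.
rewrite exchange_big/= -[x1 a1 * c]mul1r -x2s mulr_suml; apply: eq_bigr => a2 _.
have [->|x20] := eqVneq (x2 a2) 0.
  by rewrite mul0r big1// => u _; rewrite mulr0 mul0r.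
rewrite -(kc a1 _ x20) !mulr_sumr; apply: eq_bigr => u _.
by rewrite !mulrA; congr (_ * _); rewrite mulrC -mulrA [x1 a1 * _]mulrC.
Qed.

Lemma Pre1_le k (s : S) x2 c : valuation k -> mixed P2 s x2 ->
  (forall x1, mixed P1 s x1 -> expect s x1 x2 k <= c) -> Pre P1 k s <= c.
Proof.
move=> k01 m2 kc; apply: sup_image_le (mixed_neq0 _ _) _ => x1 m1.
apply: le_trans (kc _ m1).
(* The lower bound 0 ensures that the infimum lies below its members. *)
apply: (@inf_image_le _ _ _ (expect s x1 ^~ k) 0) => // y my.
by have /andP[] := expect_01 m1 my k01.
Qed.

Lemma le_Pre1 k (s : S) x1 c : valuation k -> mixed P1 s x1 ->
  (forall x2, mixed P2 s x2 -> c <= expect s x1 x2 k) -> c <= Pre P1 k s.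
Proof.
move=> k01 m1 kc; apply: (@le_trans _ _ (inf [set expect s x1 x2 k | x2 in mixed P2 s])).
  exact: le_inf_image (mixed_neq0 _ _) _.
apply: (@le_sup_image _ _ _ (fun x1 => inf [set expect s x1 x2 k | x2 in mixed P2 s]) 1) => //.
move=> y my; suff /andP[] : 0 <= inf [set expect s y x2 k | x2 in mixed P2 s] <= 1 by [].
by apply: inf_image01 (mixed_neq0 _ _) _ => z mz; exact: expect_01.
Qed.

Lemma max_expect_le k (s : S) c :
  (forall x1 x2, mixed P1 s x1 -> mixed P2 s x2 -> expect s x1 x2 k <= c) ->
  max_expect k s <= c.
Proof.
move=> kc; apply: sup_image_le (mixed_neq0 _ _) _ => x1 m1.
by apply: sup_image_le (mixed_neq0 _ _) _ => x2 m2; exact: kc.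
Qed.

Lemma le_max_expect k (s : S) x1 x2 : valuation k ->
  mixed P1 s x1 -> mixed P2 s x2 -> expect s x1 x2 k <= max_expect k s.
Proof.
move=> k01 m1 m2.
apply: (@le_trans _ _ (sup [set expect s x1 x2 k | x2 in mixed P2 s])).
  by apply: (@le_sup_image _ _ _ (expect s x1 ^~ k) 1) => // z mz; exact: expect_le1.
apply: (@le_sup_image _ _ _ (fun x1 => sup [set expect s x1 x2 k | x2 in mixed P2 s]) 1) => //.
move=> y my; apply: sup_image_le (mixed_neq0 _ _) _ => z mz; exact: expect_le1.
Qed.

Lemma gen_H_obs f d v s t : gen_H f d = d ->
  `|obs G v s - obs G v t| <= d s t.
Proof. by move=> <-; rewrite le_max obs_le_dist. Qed.

Lemma nonexpansive_obs f d v :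
  gen_H f d = d -> nonexpansive d (obs G v).
Proof.
move=> fd; split => [s|s t]; first exact: obs_01.
exact: le_trans (ler_norm _) (gen_H_obs _ _ _ fd).
Qed.

(** Observations enter [gen_H] through an absolute value, so a fixpoint bounds their differences in
    both directions and the reversed observation is a test valuation too. *)
Lemma nonexpansive_obsC f d v :
  gen_H f d = d -> nonexpansive d (fun s => 1 - obs G v s).
Proof.
move=> fd; split => [s|s t].
  have /andP[s0 s1] := obs_01 v s.
  by rewrite subr_ge0 s1 lerBlDr lerDl.
rewrite opprB addrC addrA subrK.
by apply: le_trans (gen_H_obs v s t fd); rewrite distrC ler_norm.
Qed.

End Distances.

(** * The game separating the two distances *)

Section ChoiceGame.
Variable R : realType.

Definition choice_next (s : option bool) (a : bool) : option bool :=
  if s is Some _ then s else Some a.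

Definition choice_obs (_ : unit) (s : option bool) : R := (s == Some true)%:R.

Lemma choice_obs_01 v s : 0 <= choice_obs v s <= 1.
Proof. by rewrite /choice_obs; case: eqP; rewrite ?lexx ?ler01. Qed.

Definition choice_avail (i : player) (_ : option bool) : {set bool} :=
  if i is P1 then finset.set1 true else finset.setTfor bool.

Lemma choice_avail_neq0 i s : choice_avail i s != finset.set0.
Proof. by apply/finset.set0Pn; exists true; case: i; rewrite inE. Qed.

Definition choice_trans (s : option bool) (_ a2 : bool) (u : option bool) : R :=
  (u == choice_next s a2)%:R.

Lemma choice_trans_distr s a1 a2 :
  distr (finset.setTfor (option bool)) (choice_trans s a1 a2).
Proof. by apply: dirac_distr; rewrite inE. Qed.

Definition choice_game : game_structure R :=
  GameStructure choice_obs_01 choice_avail_neq0 choice_trans_distr.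

Local Notation G := choice_game.
Implicit Types (k : state G -> R) (b : bool).

Lemma choice_MDP : is_MDP P2 G.
Proof. by move=> s; rewrite /= finset.cards1. Qed.

Lemma choice_deterministic : deterministic G.
Proof. by move=> s a1 a2; exists (choice_next s a2). Qed.

Lemma sum_choice_trans k (s : state G) a1 a2 :
  \sum_u trans G s a1 a2 u * k u = k (choice_next s a2).
Proof.
rewrite (bigD1 (choice_next s a2))//= /choice_trans eqxx mul1r big1 ?addr0//.
by move=> u /negbTE ->; rewrite mul0r.
Qed.

Lemma expect_absorbing k b x1 x2 :
  @mixed R G P1 (Some b) x1 -> @mixed R G P2 (Some b) x2 ->
  @expect R G (Some b) x1 x2 k = k (Some b).
Proof. by move=> m1 m2; apply: expect_const => // a1 a2 _; exact: sum_choice_trans. Qed.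

Definition pure b : move G -> R := fun a => (a == b)%:R.

Lemma pure_mixed b s : @mixed R G P2 s (pure b).
Proof. by apply: dirac_distr; rewrite inE. Qed.

Lemma expect_pure k b x1 : @mixed R G P1 None x1 ->
  @expect R G None x1 (pure b) k = k (Some b).
Proof.
move=> m1; apply: expect_const => //; first exact: pure_mixed.
move=> a1 a2; rewrite sum_choice_trans /pure.
by case: (a2 =P b) => [->|_]; rewrite ?eqxx.
Qed.

Lemma Pre1_absorbing k b : valuation k -> @Pre R G P1 k (Some b) = k (Some b).
Proof.
move=> k01; apply/eqP; rewrite eq_le; apply/andP; split.
  (* The reply [pure true] is arbitrary: every move stays at [Some b]. *)
  apply: (Pre1_le k01 (pure_mixed true _)) => x1 m1.
  by rewrite expect_absorbing//; exact: pure_mixed.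
have [x1 m1] := mixed_neq0 P1 (Some b : state G).
by apply: (le_Pre1 k01 m1) => x2 m2; rewrite expect_absorbing.
Qed.

(** Player 2, the minimiser here, can answer with the pure move [b]. *)
Lemma Pre1_branch_le k b : valuation k -> @Pre R G P1 k None <= k (Some b).
Proof.
move=> k01; apply: (Pre1_le k01 (pure_mixed b _)) => x1 m1.
by rewrite expect_pure.
Qed.

Lemma max_expect_absorbing k b : valuation k ->
  @max_expect R G k (Some b) = k (Some b).
Proof.
move=> k01; apply/eqP; rewrite eq_le; apply/andP; split.
  by apply: max_expect_le => x1 x2 m1 m2; rewrite expect_absorbing.
have [x1 m1] := mixed_neq0 P1 (Some b : state G).
have m2 := pure_mixed true (Some b).
by rewrite -(expect_absorbing k m1 m2); exact: le_max_expect.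
Qed.

Lemma max_expect_branch_ge k b : valuation k ->
  k (Some b) <= @max_expect R G k None.
Proof.
move=> k01; have [x1 m1] := mixed_neq0 P1 (None : state G).
by rewrite -(expect_pure k b m1); apply: le_max_expect => //; exact: pure_mixed.
Qed.

(** Serves the pair [None], [Some false], both observed as 0: only valuations can separate them. *)
Lemma choice_obs_dist_eq0 (s t : state G) :
  obs G tt s = obs G tt t -> obs_dist s t <= 0.
Proof. by move=> st; apply: obs_dist_sup => // -[]; rewrite st subrr normr0. Qed.

Lemma sim1_lt_sim12_choice :
  sim_dist G P1 None (Some false) < sim12_dist G None (Some false).
Proof.
apply: (@le_lt_trans _ _ 0).
  rewrite -sim_dist_fix; apply: gen_H_le => [||k [k01 _]].
  - by have [] := sim_distP G P1.
  - exact: choice_obs_dist_eq0.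
  - by rewrite Pre1_absorbing// subr_le0 Pre1_branch_le.
(* The test [obs] is 0 at [Some false] and 1 at [Some true], which the maximum at [None] reaches. *)
apply: (@lt_le_trans _ _ 1) => //.
have ne := nonexpansive_obs (tt : obsvar G) (sim12_dist_fix G); have [o01 _] := ne.
have := gen_sub_le (@max_expect_01 R G) None (Some false) ne.
rewrite sim12_dist_fix; apply: le_trans.
by rewrite max_expect_absorbing//= [X in _ - X]/choice_obs/= subr0 (max_expect_branch_ge true o01).
Qed.

Lemma sim12_lt_sim1_choice :
  sim12_dist G (Some false) None < sim_dist G P1 (Some false) None.
Proof.
apply: (@le_lt_trans _ _ 0).
  rewrite -sim12_dist_fix; apply: gen_H_le => [||k [k01 _]].
  - by have [] := sim12_distP G.
  - exact: choice_obs_dist_eq0.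
  - by rewrite max_expect_absorbing// subr_le0 max_expect_branch_ge.
(* The test [1 - obs] is 1 at [Some false], while from [None] player 2 can move to [Some true],
   where it is 0. *)
apply: (@lt_le_trans _ _ 1) => //.
have ne := nonexpansive_obsC (tt : obsvar G) (sim_dist_fix G P1); have [o01 _] := ne.
have := gen_sub_le (@Pre_01 R G P1) (Some false) None ne.
rewrite sim_dist_fix; apply: le_trans.
rewrite Pre1_absorbing//= {1}/choice_obs/= subr0 lerBrDl gerDr.
by have := Pre1_branch_le true o01; rewrite /= /choice_obs eqxx subrr.
Qed.

End ChoiceGame.

Theorem theorem3p15 (R : realType) :
  [/\ forall (i : player) (G : game_structure R),
        is_MDP i G -> sim_dist G i = sim12_dist G,
      exists (G : game_structure R) (s t : state G),
        [/\ is_MDP P2 G, deterministic G & sim_dist G P1 s t < sim12_dist G s t] &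
      exists (G : game_structure R) (s t : state G),
        [/\ is_MDP P2 G, deterministic G & sim_dist G P1 s t > sim12_dist G s t]].
Proof.
split; first by move=> i G; exact: MDP_sim_dist.
- exists (choice_game R), None, (Some false).
  by split; [exact: choice_MDP | exact: choice_deterministic | exact: sim1_lt_sim12_choice].
- exists (choice_game R), (Some false), None.
  by split; [exact: choice_MDP | exact: choice_deterministic | exact: sim12_lt_sim1_choice].
Qed.
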